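(* Let $K$ be an algebraically closed field and let $F(t)=\frac{N(t)}{(t-a_1)^{m_1}\cdots(t-a_k)^{m_k}}$ be a proper rational function, where $a_1,\dots,a_k\in K$ are distinct, $m_i$ are positive integers, and $M=m_1+\cdots+m_k$ is the degree of the denominator. Consider the algorithm: set $S:=0$; for $i=1,\dots,k$, let $G(t):=F(t+a_i)$, compute $\mathsf{Frac}(G(t),t^{m_i})$ via $t^{m_i}\mathsf{Frac}(G,t^{m_i})=\lceil t^{m_i}\rceil \frac{N(t+a_i)}{\prod_{j\neq i}(t+a_i-a_j)^{m_j}}$, and set $S:=S+\tau_{-a_i}\mathsf{Frac}(G(t),t^{m_i})$; return $S$. This algorithm returns the partial fraction decomposition of $F$, and it can be executed in $O(M^2)$ time.
   Context: Time is measured as the number of multiplications of elements of $K$. For $N,D\in K[t]$ with $D=D_1D'$, $D_1,D'$ relatively prime, write uniquely $N/D=p+r_1/D_1+r'/D'$ with $p,r_1,r'\in K[t]$, $\deg r_1<\deg D_1$, $\deg r'<\deg D'$; then $\mathsf{Frac}(N/D,D_1):=r_1/D_1$. $\tau_b f(t)=f(t+b)$ for $b\in K$. The map $\lceil t^m\rceil:K[[t]]\to K[t]$ is truncation: $\lceil t^m\rceil\sum_{n\ge0}a_nt^n=\sum_{n=0}^{m-1}a_nt^n$. The partial fraction decomposition of $F$ is the unique expression $F=\sum_{i=1}^k\sum_{j=1}^{m_i}A_{i,j}/(t-a_i)^j$ with $A_{i,j}\in K$. *)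

(* Defs.v *)
From HB Require Import structures.
From mathcomp Require Import all_boot all_order all_algebra.

Set Implicit Arguments.
Unset Strict Implicit.
Unset Printing Implicit Defensive.

Import GRing.Theory.
Local Open Scope ring_scope.
Local Open Scope quotient_scope.

Notation "x %:F" := (@FracField.tofrac _ x) (format "x %:F") : ring_scope.

Section RationalFunctions.

Variable K : fieldType.

(* tau b f = f(t + b); that the choice of representative does not matter is
   lemma tau_frac. *)
Definition tau (b : K) (f : {fraction {poly K}}) : {fraction {poly K}} :=
  (\n_(repr f) \Po ('X + b%:P))%:F / (\d_(repr f) \Po ('X + b%:P))%:F.

(* y = Frac(f, D1) *)
Definition is_Frac (f : {fraction {poly K}}) (D1 : {poly K})
    (y : {fraction {poly K}}) : Prop :=
  exists N D' p r1 r' : {poly K},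
    [/\ D1 * D' != 0, coprimep D1 D' & f = N%:F / (D1 * D')%:F] /\
    [/\ (size r1 < size D1)%N, (size r' < size D')%N,
        f = p%:F + r1%:F / D1%:F + r'%:F / D'%:F & y = r1%:F / D1%:F].

Lemma comp_shift_eq0 (b : K) (p : {poly K}) :
  (p \Po ('X + b%:P) == 0) = (p == 0).
Proof. by rewrite comp_poly_eq0 // size_XaddC. Qed.

Lemma comp_polyXn (p q : {poly K}) n : (p ^+ n) \Po q = (p \Po q) ^+ n.
Proof. by elim: n => [|n IH]; rewrite ?comp_polyC // !exprS comp_polyM IH. Qed.

Lemma fraction_repr (f : {fraction {poly K}}) :
  f = (\n_(repr f))%:F / (\d_(repr f))%:F.
Proof.
elim/quotW: f => x; set y := repr _.
have dy : \d_y != 0 by [].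
rewrite -[LHS]reprK -/y.
apply: (mulIf (x := (\d_y)%:F)); rewrite ?tofrac_eq0 // divfK ?tofrac_eq0 //.
unlock FracField.tofrac; rewrite -[LHS]FracField.pi_mul.
apply/eqmodP; rewrite /= FracField.equivfE /FracField.mulf.
by rewrite !numden_Ratio ?oner_neq0 ?mulf_neq0 ?oner_neq0 // !mulr1 mulrC.
Qed.

Lemma tau_frac (b : K) (p q : {poly K}) : q != 0 ->
  tau b (p%:F / q%:F) = (p \Po ('X + b%:P))%:F / (q \Po ('X + b%:P))%:F.
Proof.
move=> q0; rewrite /tau; set f := p%:F / q%:F.
have d0 : \d_(repr f) != 0 by [].
have /eqP : f = (\n_(repr f))%:F / (\d_(repr f))%:F by exact: fraction_repr.
rewrite {1}/f eqr_div ?tofrac_eq0 // -!tofracM tofrac_eq => /eqP e.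
apply/eqP; rewrite eqr_div ?tofrac_eq0 ?comp_shift_eq0 // -!tofracM.
by rewrite tofrac_eq -!comp_polyM e.
Qed.

Lemma tauD (b : K) : {morph tau b : f g / f + g}.
Proof.
move=> f g; rewrite (fraction_repr f) (fraction_repr g).
set p := \n_(repr f); set q := \d_(repr f).
set r := \n_(repr g); set s := \d_(repr g).
have q0 : q != 0 by exact: denom_ratioP.
have s0 : s != 0 by exact: denom_ratioP.
rewrite addf_div ?tofrac_eq0 // -!tofracM -tofracD.
rewrite !tau_frac ?mulf_neq0 // addf_div ?tofrac_eq0 ?comp_shift_eq0 //.
by rewrite -!tofracM -tofracD comp_polyD !comp_polyM.
Qed.

Lemma tau0 (b : K) : tau b 0 = 0.
Proof. by apply: (addrI (tau b 0)); rewrite -tauD !addr0. Qed.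

End RationalFunctions.

Section PowerSeries.

Variable K : fieldType.

(* sum_n f n * t^n in K[[t]] *)
Definition pseries := nat -> K.

Definition ps_poly (p : {poly K}) : pseries := fun n => p`_n.

Definition ps_mul (f g : pseries) : pseries :=
  fun n => \sum_(i < n.+1) f i * g (n - i)%N.

(* The first n coefficients of f^-1, from the recurrence
   sum_(i <= n) (f^-1)_i f_(n - i) = [n = 0]. *)
Fixpoint ps_inv_coefs (f : pseries) (n : nat) : seq K :=
  if n is n'.+1 then
    let s := ps_inv_coefs f n' in
    rcons s ((f 0%N)^-1 * ((n' == 0%N)%:R - \sum_(i < n') s`_i * f (n' - i)%N))
  else [::].

Definition ps_inv (f : pseries) : pseries := fun n => (ps_inv_coefs f n.+1)`_n.

Definition ps_div (f g : pseries) : pseries := ps_mul f (ps_inv g).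

Definition ps_trunc (m : nat) (f : pseries) : {poly K} := \poly_(n < m) f n.

Lemma size_ps_inv_coefs f n : size (ps_inv_coefs f n) = n.
Proof. by elim: n => //= n IH; rewrite size_rcons IH. Qed.

Lemma nth_ps_inv_coefs f n i : (i < n)%N -> (ps_inv_coefs f n)`_i = ps_inv f i.
Proof.
elim: n => // n IH; rewrite ltnS leq_eqVlt => /orP[/eqP -> //|lt_in].
by rewrite /= nth_rcons size_ps_inv_coefs lt_in IH.
Qed.

Lemma ps_mulVf f n : f 0%N != 0 -> ps_mul (ps_inv f) f n = (n == 0%N)%:R.
Proof.
move=> f0; rewrite /ps_mul big_ord_recr /= subnn {2}/ps_inv /=.
rewrite nth_rcons size_ps_inv_coefs ltnn eqxx mulrC mulVKf //.
under [X in _ - X]eq_bigr => i _ do rewrite nth_ps_inv_coefs //.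
by rewrite addrC subrK.
Qed.

End PowerSeries.

Section Algorithm.

Variable K : fieldType.

(* A formal sum of terms A / (t - b)^j, each encoded as (A, b, j). *)
Definition pf_expr := seq (K * K * nat).

Definition pf_eval (S : pf_expr) : {fraction {poly K}} :=
  \sum_(x <- S) (x.1.1%:P)%:F / (('X - x.1.2%:P) ^+ x.2)%:F.

(* tau b, acting term by term: A / (t + b - c)^j *)
Definition pf_tau (b : K) (S : pf_expr) : pf_expr :=
  [seq (x.1.1, x.1.2 - b, x.2) | x <- S].

(* c / t^m, for deg c < m *)
Definition pf_of_trunc (m : nat) (c : {poly K}) : pf_expr :=
  [seq (c`_(m - j), 0, j) | j <- iota 1 m].

Variables (k : nat) (a : 'I_k -> K) (m : 'I_k -> nat) (N : {poly K}).

Definition pf_den : {poly K} := \prod_(i < k) ('X - (a i)%:P) ^+ m i.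

Definition pf_rat : {fraction {poly K}} := N%:F / pf_den%:F.

(* t^(m_i) Frac(G, t^(m_i)), as computed in iteration i *)
Definition pf_trunc (i : 'I_k) : {poly K} :=
  ps_trunc (m i)
    (ps_div (ps_poly (N \Po ('X + (a i)%:P)))
            (ps_poly (\prod_(j < k | j != i) ('X + (a i - a j)%:P) ^+ m j))).

Definition pf_step (S : pf_expr) (i : 'I_k) : pf_expr :=
  S ++ pf_tau (- a i) (pf_of_trunc (m i) (pf_trunc i)).

(* The value of S after n iterations. *)
Definition pf_state (n : nat) : pf_expr :=
  foldl pf_step [::] (take n (enum 'I_k)).

Definition pf_algorithm : pf_expr := pf_state k.

(* sum_i sum_(1 <= j <= m_i) A i j / (t - a_i)^j *)
Definition pf_form (A : 'I_k -> nat -> K) : pf_expr :=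
  flatten [seq [seq (A i j, a i, j) | j <- iota 1 (m i)] | i <- enum 'I_k].

Definition is_pfd (F : {fraction {poly K}}) (S : pf_expr) : Prop :=
  [/\ exists A, S = pf_form A,
      pf_eval S = F
    & forall A, pf_eval (pf_form A) = F -> pf_form A = S].

End Algorithm.

Lemma pf_eval_tau (K : fieldType) (b : K) (S : pf_expr K) :
  pf_eval (pf_tau b S) = tau b (pf_eval S).
Proof.
elim: S => [|[[A c] j] S IH]; first by rewrite /pf_eval !big_nil tau0.
rewrite /pf_eval /= !big_cons tauD -/(pf_eval S) -IH; congr (_ + _).
rewrite /= tau_frac ?expf_neq0 ?polyXsubC_eq0 //.
rewrite comp_polyC comp_polyXn comp_polyB comp_polyX comp_polyC polyCB.
by rewrite opprB addrA addrAC.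
Qed.

Lemma pf_eval_of_trunc (K : fieldType) (m : nat) (c : {poly K}) :
  (size c <= m)%N -> pf_eval (pf_of_trunc m c) = c%:F / ('X^m)%:F.
Proof.
move=> le_cm; rewrite /pf_eval big_map /=.
have X0 : ('X^m : {poly K})%:F != 0 by rewrite tofrac_eq0 monic_neq0 ?monicXn.
apply: (mulIf X0); rewrite divfK // mulr_suml.
have def_c : c = \sum_(j <- iota 1 m) (c`_(m - j))%:P * 'X^(m - j).
  rewrite {1}(_ : c = \poly_(i < m) c`_i); last first.
    apply/polyP => i; rewrite coef_poly; case: ltnP => // le_mi.
    by rewrite nth_default // (leq_trans le_cm).
  rewrite poly_def (reindex_inj rev_ord_inj) /=
          (iotaDl 1 0 m) big_map (_ : iota 0 m = index_iota 0 m) ?big_mkord;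
    last by rewrite /index_iota subn0.
  by apply: eq_bigr => i _; rewrite mul_polyC.
rewrite [in RHS]def_c rmorph_sum /=; apply: eq_big_seq => j.
rewrite mem_iota => /andP[j0 jm].
have Xj0 : ('X^j : {poly K})%:F != 0 by rewrite tofrac_eq0 monic_neq0 ?monicXn.
rewrite subr0 tofracM -mulrA; congr (_ * _); apply: (mulfI Xj0).
by rewrite mulVKf // -tofracM -exprD subnKC // -ltnS -add1n.
Qed.

(* Straight-line programs over K: each instruction appends one value to the
   memory, operands being memory addresses.  An address outside the memory
   reads as 0. *)
Inductive instr :=
  | IZero | IOne
  | IAdd of nat & nat | ISub of nat & nat
  | IMul of nat & nat | IDiv of nat & nat.

(* Divisions are charged as multiplications: were they free, squares, hence
   (in characteristic other than 2) all products, would be free as well, by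
   x^2 = 1 / (1 / x - 1 / (x + 1)) - x. *)
Definition instr_cost (c : instr) : nat :=
  match c with IMul _ _ | IDiv _ _ => 1 | _ => 0 end.

Definition slp_cost (P : seq instr) : nat := \sum_(c <- P) instr_cost c.

Section Execution.

Variable K : fieldType.

Definition instr_val (mem : seq K) (c : instr) : option K :=
  match c with
  | IZero => Some 0
  | IOne => Some 1
  | IAdd x y => Some (mem`_x + mem`_y)
  | ISub x y => Some (mem`_x - mem`_y)
  | IMul x y => Some (mem`_x * mem`_y)
  | IDiv x y => if mem`_y == 0 then None else Some (mem`_x / mem`_y)
  end.

(* None when a division by 0 occurs *)
Fixpoint slp_run (mem : seq K) (P : seq instr) : option (seq K) :=
  if P is c :: P' then
    if instr_val mem c is Some v then slp_run (rcons mem v) P' else None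
  else Some mem.

(* The expression whose numerators and poles are stored at the given
   addresses. *)
Definition pf_read (mem : seq K) (d : seq (nat * nat * nat)) : pf_expr K :=
  [seq (mem`_x.1.1, mem`_x.1.2, x.2) | x <- d].

(* The M = m_1 + ... + m_k coefficients of N, then a_1, ..., a_k. *)
Definition pf_input k (a : 'I_k -> K) (m : 'I_k -> nat) (N : {poly K}) : seq K :=
  mkseq (fun n => N`_n) (\sum_(i < k) m i) ++ [seq a i | i <- enum 'I_k].

End Execution.

(* iter_code i is the code of the i-th iteration (counted from 0); state_addr n
   lists the addresses of the terms of S after n iterations. *)
Record pf_program := PfProgram {
  iter_code : nat -> seq instr;
  state_addr : nat -> seq (nat * nat * nat)
}.

Definition pf_program_cost (P : pf_program) (k : nat) : nat :=
  \sum_(i < k) slp_cost (iter_code P i).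

Definition executes (K : fieldType) k (a : 'I_k -> K) (m : 'I_k -> nat)
    (N : {poly K}) (P : pf_program) : Prop :=
  forall n, (n <= k)%N ->
    exists2 mem, slp_run (pf_input a m N)
                   (flatten [seq iter_code P i | i <- iota 0 n]) = Some mem
               & pf_read mem (state_addr P n) = pf_state a m N n.

(* Main.v *)
Require Import Defs.
From mathcomp Require Import all_boot all_order all_algebra.
From mathcomp Require Import ring.
Import GRing.Theory.
Local Open Scope ring_scope.

(* Correctness: the truncation c_i is the only polynomial of degree < m_i with
   N(t + a_i) = c_i * prod_(j != i) (t + a_i - a_j)^(m_j) modulo t^(m_i).
   Hence N - sum_i c_i(t - a_i) * prod_(j != i) (t - a_j)^(m_j) is divisible by
   every (t - a_i)^(m_i), so by the denominator of F, and it vanishes because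
   its degree is smaller; the same congruence gives uniqueness.

   Cost: iteration i works modulo t^(m_i).  Horner's scheme yields N(t + a_i)
   through M multiplications by t + a_i; the quotient is then obtained without
   expanding the denominator, through M - m_i divisions by a linear factor
   t + a_i - a_j.  Each of these steps costs m_i operations, whence at most
   2 M m_i in iteration i and 2 M^2 in total. *)

Set Implicit Arguments.
Unset Strict Implicit.
Unset Printing Implicit Defensive.

(** * Truncated quotients of power series as congruences modulo powers of t *)

Section Truncation.
Variable K : fieldType.
Implicit Types p q c D N : {poly K}.

Lemma dvdXnP (m : nat) p : reflect (forall n, (n < m)%N -> p`_n = 0) ('X^m %| p).
Proof.
apply: (iffP idP) => [/dvdpP[q ->] n nm|p0]; first by rewrite coefMXn nm.
rewrite -(poly_take_drop m p) (_ : take_poly m p = 0) ?add0r ?dvdp_mulIr //.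
by apply/polyP => n; rewrite coef_take_poly coef0; case: ltnP => // /p0.
Qed.

Lemma coprimep_Xn (m : nat) D : D`_0 != 0 -> coprimep 'X^m D.
Proof. by move=> D0; rewrite coprimep_expl // coprimep_sym coprimepX /root horner_coef0. Qed.

Lemma dvdXn_ps_trunc (m : nat) N D : D`_0 != 0 ->
  'X^m %| N - ps_trunc m (ps_div (ps_poly N) (ps_poly D)) * D.
Proof.
(* [T] is the truncated inverse of [D]. Coefficients below [m] of a product depend only on
   coefficients below [m] of the factors, so [T * D] is 1 and [c] is [N * T] modulo t^m. *)
move=> D0; set c := ps_trunc _ _; pose T := ps_trunc m (ps_inv (ps_poly D)).
have TD : 'X^m %| 1 - T * D.
  apply/dvdXnP => n nm; rewrite coefB coef1 coefM.
  rewrite -(@ps_mulVf _ (ps_poly D) n) // /ps_mul.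
  apply/eqP; rewrite subr_eq0; apply/eqP/eq_bigr => i _.
  by rewrite coef_poly (leq_ltn_trans (leq_ord i)).
have cNT : 'X^m %| c - N * T.
  apply/dvdXnP => n nm; rewrite coefB coefM coef_poly nm.
  apply/eqP; rewrite subr_eq0; apply/eqP/eq_bigr => i _.
  by rewrite coef_poly (leq_ltn_trans (leq_subr _ _)).
have -> : N - c * D = N * (1 - T * D) - (c - N * T) * D by ring.
by apply: dvdp_sub; [exact: dvdp_mull | exact: dvdp_mulr].
Qed.

(** Since [D] is coprime to t^m, two solutions differ by a multiple of t^m of degree below m. This
    also identifies the output of the program later on. *)
Lemma ps_trunc_unique (m : nat) N D c : D`_0 != 0 -> (size c <= m)%N ->
  'X^m %| N - c * D -> c = ps_trunc m (ps_div (ps_poly N) (ps_poly D)).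
Proof.
move=> D0 cm Nc; set c' := ps_trunc _ _.
have c'm : (size c' <= m)%N by exact: size_poly.
have: 'X^m %| (c - c') * D.
  have -> : (c - c') * D = (N - c' * D) - (N - c * D) by ring.
  by rewrite dvdp_sub ?dvdXn_ps_trunc.
rewrite Gauss_dvdpl ?coprimep_Xn // => dv; apply/eqP; rewrite -subr_eq0.
apply: contraLR dv => nz; rewrite gtNdvdp // size_polyXn ltnS.
by rewrite (leq_trans (size_polyD _ _)) // size_polyN geq_max cm.
Qed.

End Truncation.

(** * Divisibility under translation and by products of coprime factors *)

Section Polynomials.
Variable K : fieldType.
Implicit Types p q : {poly K}.

Lemma dvdp_shift (b : K) (p q : {poly K}) :
  (p \Po ('X + b%:P) %| q \Po ('X + b%:P)) = (p %| q).
Proof.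
apply/idP/idP => [/(dvdp_comp_poly ('X - b%:P))|/dvdp_comp_poly //].
by rewrite -!comp_polyA comp_polyD comp_polyX comp_polyC subrK !comp_polyXr.
Qed.

Lemma size_comp_XsubC (b : K) (p : {poly K}) : size (p \Po ('X - b%:P)) = size p.
Proof. by rewrite size_comp_poly2 // size_XsubC. Qed.

Lemma dvdp_coprime_prod (I : eqType) (r : seq I) (f : I -> {poly K}) p :
  uniq r -> (forall i j, i != j -> coprimep (f i) (f j)) ->
  (forall i, f i %| p) -> \prod_(i <- r) f i %| p.
Proof.
move=> + cop dv; elim: r => [|i r IH] /=; first by rewrite big_nil dvd1p.
case/andP=> ir /IH dr; rewrite big_cons Gauss_dvdp ?dv //.
rewrite big_seq; apply: (big_ind (fun q => coprimep (f i) q)).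
- exact: coprimep1.
- by move=> x y cx cy; rewrite coprimepMr cx.
- by move=> j jr; apply: cop; apply: contraNneq ir => ->.
Qed.

End Polynomials.

(** * Correctness of the algorithm and uniqueness of the decomposition *)

Section PartialFractions.
Variables (K : fieldType) (k : nat) (a : 'I_k -> K) (m : 'I_k -> nat).
Hypothesis a_inj : injective a.

Definition coden (i : 'I_k) : {poly K} :=
  \prod_(j < k | j != i) ('X - (a j)%:P) ^+ m j.

Definition shift_coden (i : 'I_k) : {poly K} :=
  \prod_(j < k | j != i) ('X + (a i - a j)%:P) ^+ m j.

Lemma pf_denD1 (i : 'I_k) : pf_den a m = ('X - (a i)%:P) ^+ m i * coden i.
Proof. by rewrite /pf_den (bigD1 i). Qed.

Lemma coden_shift (i : 'I_k) : coden i \Po ('X + (a i)%:P) = shift_coden i.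
Proof.
rewrite rmorph_prod; apply: eq_bigr => j _ /=.
by rewrite comp_polyXn comp_polyB comp_polyX comp_polyC polyCB addrA.
Qed.

(** The constant term is the product of the (a_i - a_j)^(m_j); distinct poles make the cofactor
    invertible as a power series. *)
Lemma shift_coden0 (i : 'I_k) : (shift_coden i)`_0 != 0.
Proof.
rewrite -horner_coef0 horner_prod prodf_seq_neq0.
apply/allP => j _; apply/implyP => ji.
by rewrite horner_exp !hornerE expf_neq0 // subr_eq0 (inj_eq a_inj) eq_sym.
Qed.

Lemma pf_den_neq0 : pf_den a m != 0.
Proof. by apply/prodf_neq0 => i _; rewrite expf_neq0 ?polyXsubC_eq0. Qed.

Lemma coden_neq0 (i : 'I_k) : coden i != 0.
Proof. by apply/prodf_neq0 => j _; rewrite expf_neq0 ?polyXsubC_eq0. Qed.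

Lemma size_pf_den : size (pf_den a m) = (\sum_(i < k) m i).+1.
Proof.
rewrite size_prod => [|i _]; last by rewrite expf_neq0 ?polyXsubC_eq0.
under eq_bigr => i _ do rewrite size_exp_XsubC -add1n.
by rewrite big_split /= sum1_card -addnS addKn.
Qed.

Lemma pf_block_eval (i : 'I_k) (c : {poly K}) : (size c <= m i)%N ->
  pf_eval (pf_tau (- a i) (pf_of_trunc (m i) c)) =
  (c \Po ('X - (a i)%:P))%:F / (('X - (a i)%:P) ^+ m i)%:F.
Proof.
move=> cm; rewrite pf_eval_tau pf_eval_of_trunc //.
by rewrite tau_frac ?monic_neq0 ?monicXn // comp_polyXn comp_polyX polyCN.
Qed.

Lemma sum_frac_coden (u : 'I_k -> {poly K}) :
  \sum_(i < k) (u i)%:F / (('X - (a i)%:P) ^+ m i)%:F =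
  (\sum_(i < k) u i * coden i)%:F / (pf_den a m)%:F.
Proof.
rewrite rmorph_sum /= mulr_suml; apply: eq_bigr => i _.
by rewrite (pf_denD1 i) !tofracM -mulf_div divff ?mulr1 // tofrac_eq0 coden_neq0.
Qed.

Variable N : {poly K}.

(** Translation by a_i carries the congruence at 0 solved by the truncation to a congruence at the
    pole a_i. *)
Lemma dvdXn_shift (i : 'I_k) (c : {poly K}) :
  ('X^(m i) %| N \Po ('X + (a i)%:P) - c * shift_coden i) =
  (('X - (a i)%:P) ^+ m i %| N - (c \Po ('X - (a i)%:P)) * coden i).
Proof.
rewrite -[RHS](dvdp_shift (a i)) comp_polyXn !comp_polyB comp_polyM coden_shift.
by rewrite -comp_polyA comp_polyB comp_polyX comp_polyC addrK comp_polyXr.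
Qed.

Lemma pf_trunc_unique (i : 'I_k) (c : {poly K}) : (size c <= m i)%N ->
  ('X - (a i)%:P) ^+ m i %| N - (c \Po ('X - (a i)%:P)) * coden i ->
  c = pf_trunc a m N i.
Proof.
by move=> cm; rewrite -dvdXn_shift; apply: ps_trunc_unique => //; apply: shift_coden0.
Qed.

Lemma dvdp_pf_trunc (i : 'I_k) :
  ('X - (a i)%:P) ^+ m i %|
    N - (pf_trunc a m N i \Po ('X - (a i)%:P)) * coden i.
Proof. by rewrite -dvdXn_shift; apply/dvdXn_ps_trunc/shift_coden0. Qed.

Lemma size_pf_trunc (i : 'I_k) : (size (pf_trunc a m N i) <= m i)%N.
Proof. exact: size_poly. Qed.

Lemma dvdp_coden (i j : 'I_k) : j != i -> ('X - (a i)%:P) ^+ m i %| coden j.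
Proof.
by move=> ji; rewrite /coden (bigD1 i) 1?eq_sym //= dvdp_mulIl.
Qed.

Lemma pf_sum_trunc : (size N < size (pf_den a m))%N ->
  \sum_(i < k) (pf_trunc a m N i \Po ('X - (a i)%:P)) * coden i = N.
Proof.
move=> ltN; set u := \sum_(i < k) _; apply/eqP; rewrite eq_sym -subr_eq0.
have dv : pf_den a m %| N - u.
  apply: dvdp_coprime_prod => [|i j ij|i].
  - exact: index_enum_uniq.
  - rewrite coprimep_expl ?coprimep_expr ?coprimep_XsubC2 ?subr_eq0 //.
    by rewrite (inj_eq a_inj) eq_sym.
  (* The i-th summand agrees with [N] modulo (t - a_i)^(m_i); every other summand contains that
     power in its cofactor. *)
  rewrite /u (bigD1 i) //= opprD addrA dvdp_sub ?dvdp_pf_trunc //.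
  by apply: (big_ind (fun q => _ %| q)) => [|p q|j ji];
    rewrite ?dvdp0 //; [apply: dvdp_add | rewrite dvdp_mull ?dvdp_coden].
(* Degree count: c_i has degree below m_i and its cofactor has degree M - m_i, so each summand, like
   [N], has degree below M. *)
apply: contraLR dv => nz; rewrite gtNdvdp // size_pf_den ltnS.
rewrite (leq_trans (size_polyD _ _)) // size_polyN geq_max.
rewrite -ltnS -size_pf_den ltN /=; apply: (leq_trans (size_sum _ _ _)).
apply/bigmax_leqP => i _; rewrite -ltnS -size_pf_den (pf_denD1 i).
rewrite [X in (_ < X)%N]size_mul ?expf_neq0 ?polyXsubC_eq0 ?coden_neq0 //.
rewrite size_exp_XsubC addSn /= (leq_ltn_trans (size_polyMleq _ _)) //.
rewrite size_comp_XsubC; have := size_pf_trunc i; have: (0 < size (coden i))%N.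
  by rewrite size_poly_gt0 coden_neq0.
case: (size (coden i)) => // s _; rewrite addnS /= addnS ltnS => le_c.
by rewrite leq_add2r.
Qed.

(** Modulo (t - a_i)^(m_i) only the i-th summand survives, so [c i] satisfies the congruence that
    determines the truncation. *)
Lemma pf_sum_unique (c : 'I_k -> {poly K}) : (forall i, size (c i) <= m i)%N ->
  \sum_(i < k) (c i \Po ('X - (a i)%:P)) * coden i = N ->
  forall i, c i = pf_trunc a m N i.
Proof.
move=> cm defN i; apply: pf_trunc_unique => //.
rewrite -{1}defN (bigD1 i) //= addrC addrK.
by apply: (big_ind (fun q => _ %| q)) => [|p q|j ji];
  rewrite ?dvdp0 //; [apply: dvdp_add | rewrite dvdp_mull ?dvdp_coden].
Qed.

Lemma is_Frac_pf_trunc (i : 'I_k) :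
  is_Frac (tau (a i) (pf_rat a m N)) 'X^(m i)
    (pf_eval (pf_of_trunc (m i) (pf_trunc a m N i))).
Proof.
have Xm0 : 'X^(m i) != 0 :> {poly K} by rewrite monic_neq0 ?monicXn.
have D0 : shift_coden i != 0 by rewrite -coden_shift comp_shift_eq0 coden_neq0.
set c := pf_trunc a m N i; pose Ni := N \Po ('X + (a i)%:P).
have /dvdpP[h Nh] : 'X^(m i) %| Ni - c * shift_coden i.
  by rewrite dvdXn_shift dvdp_pf_trunc.
have tauE : tau (a i) (pf_rat a m N) = Ni%:F / ('X^(m i) * shift_coden i)%:F.
  rewrite /pf_rat tau_frac ?pf_den_neq0 // (pf_denD1 i) comp_polyM coden_shift.
  by rewrite comp_polyXn comp_polyB comp_polyX comp_polyC addrK.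
(* From [Ni] = c D' + h t^(m_i), the fraction is c / t^(m_i) + h / D'; Euclidean division of h by D'
   separates the polynomial part from the proper one. *)
exists Ni, (shift_coden i), (h %/ shift_coden i), c, (h %% shift_coden i).
split; split => //.
- by rewrite mulf_neq0.
- by apply/coprimep_Xn/shift_coden0.
- by rewrite size_polyXn ltnS size_pf_trunc.
- by rewrite ltn_modp.
- rewrite tauE addrAC -[(h %/ _)%:F](mulfK (x := (shift_coden i)%:F)) ?tofrac_eq0 //.
  rewrite -mulrDl -tofracM -tofracD -divp_eq addf_div ?tofrac_eq0 //.
  by rewrite -!tofracM -tofracD -Nh subrK [shift_coden i * _]mulrC.
- by rewrite pf_eval_of_trunc ?size_pf_trunc.
Qed.

Lemma pf_stateE (n : nat) :
  pf_state a m N n =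
  flatten [seq [seq ((pf_trunc a m N i)`_(m i - j), a i, j) | j <- iota 1 (m i)]
          | i <- take n (enum 'I_k)].
Proof.
rewrite /pf_state -[RHS]cat0s; elim: (take _ _) [::] => [|i r IH] S /=.
  by rewrite cats0.
rewrite IH /pf_step -catA /pf_tau /pf_of_trunc -map_comp.
by congr (_ ++ (_ ++ _)); apply: eq_map => j /=; rewrite sub0r opprK.
Qed.

(** As A / t^j = A t^(m_i - j) / t^(m_i), any family of coefficients comes from polynomials of
    degree below m_i, to which [pf_sum_unique] applies. *)
Lemma pf_formE (A : 'I_k -> nat -> K) :
  pf_form a m A = flatten [seq pf_tau (- a i)
    (pf_of_trunc (m i) (\poly_(n < m i) A i (m i - n)%N)) | i <- enum 'I_k].
Proof.
congr flatten; apply: eq_map => i; rewrite /pf_tau /pf_of_trunc -map_comp.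
apply/eq_in_map => j; rewrite mem_iota add1n ltnS => /andP[j0 jm] /=.
rewrite sub0r opprK coef_poly; case: ltnP; first by rewrite subKn.
by rewrite leqNgt ltn_subrL j0 (leq_trans j0 jm).
Qed.

Lemma pf_eval_form (A : 'I_k -> nat -> K) :
  pf_eval (pf_form a m A) =
  (\sum_(i < k) ((\poly_(n < m i) A i (m i - n)%N) \Po ('X - (a i)%:P)) *
    coden i)%:F / (pf_den a m)%:F.
Proof.
rewrite -sum_frac_coden pf_formE /pf_eval big_flatten big_map /= big_enum /=.
by apply: eq_bigr => i _; rewrite -pf_block_eval ?size_poly.
Qed.

Lemma pf_algorithm_is_pfd : (size N < size (pf_den a m))%N ->
  is_pfd a m (pf_rat a m N) (pf_algorithm a m N).
Proof.
move=> ltN; pose A i j := (pf_trunc a m N i)`_(m i - j).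
have algE : pf_algorithm a m N = pf_form a m A.
  by rewrite /pf_algorithm pf_stateE take_oversize // size_enum_ord.
rewrite algE; split; first by exists A.
  rewrite pf_eval_form /pf_rat -[in RHS](pf_sum_trunc ltN); congr (_%:F / _).
  apply: eq_bigr => i _; congr ((_ \Po _) * _); apply/polyP => n.
  rewrite coef_poly; case: ltnP => [lt_n|le_n]; first by rewrite /A subKn // ltnW.
  by rewrite nth_default // (leq_trans (size_pf_trunc i)).
(* Over the common denominator the numerators must agree, which fixes the polynomial built from [B]
   at each pole. *)
move=> B; rewrite pf_eval_form /pf_rat => /mulIf eqB.
have/eqP := eqB ltac:(by rewrite invr_eq0 tofrac_eq0 pf_den_neq0).
rewrite tofrac_eq => /eqP/pf_sum_unique cB.
congr flatten; apply: eq_map => i; apply/eq_in_map => j.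
rewrite mem_iota add1n ltnS => /andP[j0 jm]; congr (_, _, _).
rewrite /A -cB; first by rewrite coef_poly ltn_subrL j0 (leq_trans j0 jm) subKn.
by move=> i'; apply: size_poly.
Qed.

End PartialFractions.

(** * Multiplication and division of truncated series by linear factors *)

Section LinearSteps.
Variable K : fieldType.
Implicit Types (s : seq K) (b c x : K).

(** One Horner step: coefficient n of s (t + b) is s_n b + s_(n-1), and the seed [x], in the place
    of s_(-1), is added to the constant term. *)
Definition mul_lin b x s : seq K := pairmap (fun y z => z * b + y) x s.

(** The quotient q by t + c obeys q_n = (s_n - q_(n-1)) / c. The seed [x] stands for q_(-1) and is 0
    for a plain division; other values serve the induction. *)
Definition div_lin c x s : seq K := scanl (fun y z => (z - y) / c) x s.

Lemma mul_linP b x s :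
  'X^(size s) %| Poly (mul_lin b x s) - (Poly s * ('X + b%:P) + x%:P).
Proof.
elim: s x => [|y s IH] x; first by rewrite dvd1p.
rewrite /= !cons_poly_def polyCD polyCM.
set p := Poly (pairmap _ _ _); set q := Poly s.
(* The error is t times the error for the tail, whose seed is the coefficient just passed. *)
have -> : p * 'X + (y%:P * b%:P + x%:P) - ((q * 'X + y%:P) * ('X + b%:P) + x%:P)
        = (p - (q * ('X + b%:P) + y%:P)) * 'X by ring.
by rewrite exprSr dvdp_mul2r ?polyX_eq0 ?IH.
Qed.

Lemma div_linP c x s : c != 0 ->
  'X^(size s) %| Poly (div_lin c x s) * ('X + c%:P) - (Poly s - x%:P).
Proof.
move=> c0; elim: s x => [|y s IH] x; first by rewrite dvd1p.
rewrite /= !cons_poly_def; set z := (y - x) / c.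
have -> : y = z * c + x by rewrite divfK ?subrK.
rewrite polyCD [(z * c)%:P]polyCM; set p := Poly (scanl _ _ _); set q := Poly s.
have -> : (p * 'X + z%:P) * ('X + c%:P) - (q * 'X + (z%:P * c%:P + x%:P) - x%:P)
        = (p * ('X + c%:P) - (q - z%:P)) * 'X by ring.
by rewrite exprSr dvdp_mul2r ?polyX_eq0 ?IH.
Qed.

End LinearSteps.

(* Read against an environment e of input values, a step acts on the list of
   the first coefficients of a power series: SMul y multiplies by t + b and
   adds e y; SDiv y divides by t + b - e y. *)
Inductive step := SMul of nat | SDiv of nat.

Definition step_val (K : fieldType) (e : nat -> K) (b : K) (s : seq K) (st : step) :=
  match st with
  | SMul y => mul_lin b (e y) s
  | SDiv y => div_lin (b - e y) 0 s
  end.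

Definition step_addr (st : step) := match st with SMul y | SDiv y => y end.

Definition step_def (K : fieldType) (e : nat -> K) (b : K) (st : step) :=
  if st is SDiv y then b != e y else true.

Section StepValues.
Variables (K : fieldType) (e : nat -> K) (b : K).

Lemma size_step_val s st : size (step_val e b s st) = size s.
Proof. by case: st => y /=; rewrite ?size_pairmap ?size_scanl. Qed.

Lemma size_steps_val s sts : size (foldl (step_val e b) s sts) = size s.
Proof. by elim: sts s => //= st sts IH s; rewrite IH size_step_val. Qed.

(** Horner's scheme starts from the top coefficient, hence [rev]; the induction peels off the lowest
    coefficient, which is processed last. *)
Lemma mul_steps_val n (r : seq nat) :
  let s := foldl (step_val e b) (nseq n 0) (rev (map SMul r)) in
  'X^n %| Poly [seq e y | y <- r] \Po ('X + b%:P) - Poly s.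
Proof.
rewrite /= foldl_rev; elim: r => [|y r IH] /=.
  rewrite comp_poly0 sub0r dvdpNr (_ : Poly _ = 0) ?dvdp0 //.
  by apply/polyP => i; rewrite coef_Poly nth_nseq coef0 if_same.
set s := foldr _ _ _ in IH *.
have sn : size s = n by rewrite /s -foldl_rev size_steps_val size_nseq.
have := mul_linP b (e y) s; rewrite sn cons_poly_def comp_polyD comp_polyM.
rewrite comp_polyX comp_polyC; set p := Poly (mul_lin _ _ _).
set q := _ \Po _ in IH * => h.
have -> : q * ('X + b%:P) + (e y)%:P - p = (q - Poly s) * ('X + b%:P)
   - (p - (Poly s * ('X + b%:P) + (e y)%:P)) by ring.
by apply: dvdp_sub => //; apply: dvdp_mulr.
Qed.

Lemma div_steps_val s (r : seq nat) : all (fun y => b != e y) r ->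
  let s' := foldl (step_val e b) s (map SDiv r) in
  'X^(size s) %| Poly s - Poly s' * \prod_(y <- r) ('X + (b - e y)%:P).
Proof.
elim: r s => [|y r IH] s /=; first by rewrite big_nil mulr1 subrr dvdp0.
case/andP=> by0 /IH{}IH; set s1 := div_lin _ _ _.
have := IH s1; rewrite /= size_scanl big_cons.
set p := Poly (foldl _ _ _); set P := \prod_(_ <- _) _ => h1.
have := @div_linP _ (b - e y) 0 s; rewrite subr_eq0 => /(_ by0).
rewrite -/s1 subr0; set L := 'X + _ => h2.
have -> : Poly s - p * (L * P) = (Poly s1 - p * P) * L - (Poly s1 * L - Poly s) by ring.
by apply: dvdp_sub => //; apply: dvdp_mulr.
Qed.

End StepValues.

(** * Straight-line code for the steps and its cost *)

(* L is the length of the memory when the code starts. *)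
Fixpoint mul_code (b L x : nat) (v : seq nat) : seq instr :=
  if v is y :: v' then [:: IMul y b, IAdd L x & mul_code b L.+2 y v'] else [::].

Fixpoint div_code (c L x : nat) (v : seq nat) : seq instr :=
  if v is y :: v' then [:: ISub y x, IDiv L c & div_code c L.+2 L.+1 v'] else [::].

(** Each coefficient takes two instructions, the second of which stores the result. *)
Fixpoint odd_addrs (L n : nat) : seq nat :=
  if n is n'.+1 then L.+1 :: odd_addrs L.+2 n' else [::].

(** A division first stores c = b - e y at address [L], which moves its results by one; [z] is the
    address of a zero, the seed of the recurrence. *)
Definition step_code (z b L : nat) (v : seq nat) (st : step) : seq instr * seq nat :=
  match st with
  | SMul y => (mul_code b L y v, odd_addrs L (size v))
  | SDiv y => (ISub b y :: div_code L L.+1 z v, odd_addrs L.+1 (size v))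
  end.

Fixpoint steps_code (z b L : nat) (v : seq nat) (sts : seq step) :
    seq instr * seq nat :=
  if sts is st :: sts' then
    let: (c, v') := step_code z b L v st in
    let: (c', v'') := steps_code z b (L + size c) v' sts' in
    (c ++ c', v'')
  else ([::], v).

Lemma slp_cost_cat P Q : slp_cost (P ++ Q) = (slp_cost P + slp_cost Q)%N.
Proof. exact: big_cat. Qed.

Lemma slp_cost_cons c P : slp_cost (c :: P) = (instr_cost c + slp_cost P)%N.
Proof. exact: big_cons. Qed.

Lemma slp_cost_mul b L x v : slp_cost (mul_code b L x v) = size v.
Proof.
elim: v L x => [|y v IH] L x /=; first by rewrite /slp_cost big_nil.
by rewrite !slp_cost_cons IH.
Qed.

Lemma slp_cost_div c L x v : slp_cost (div_code c L x v) = size v.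
Proof.
elim: v L x => [|y v IH] L x /=; first by rewrite /slp_cost big_nil.
by rewrite !slp_cost_cons IH.
Qed.

Lemma size_odd_addrs L n : size (odd_addrs L n) = n.
Proof. by elim: n L => //= n IH L; rewrite IH. Qed.

(** Every step spends one multiplication or division per coefficient and preserves the number of
    coefficients. *)
Lemma slp_cost_steps z b L v sts :
  slp_cost (steps_code z b L v sts).1 = (size sts * size v)%N.
Proof.
elim: sts L v => [|st sts IH] L v /=; first by rewrite /slp_cost big_nil.
case E: (step_code z b L v st) => [c v'].
have [cc cv] : slp_cost c = size v /\ size v' = size v.
  case: st E => y /= [<- <-]; rewrite ?slp_cost_cons ?slp_cost_mul ?slp_cost_div.
    by rewrite size_odd_addrs.
  by rewrite size_odd_addrs.
have := IH (L + size c)%N v'; case: (steps_code _ _ _ _ _) => c' v'' /= h.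
by rewrite slp_cost_cat cc h cv mulSn.
Qed.

(** * Correctness of the generated code *)

Section Semantics.
Variable K : fieldType.
Implicit Types (mem s w : seq K) (P Q : seq instr) (v : seq nat).

Lemma slp_run_cat mem P Q :
  slp_run mem (P ++ Q) = obind (fun mem' => slp_run mem' Q) (slp_run mem P).
Proof. by elim: P mem => //= c P IH mem; case: instr_val. Qed.

(** The bound matters because an address outside the memory reads as 0 until the memory grows past
    it; addresses inside keep their values. *)
Definition reads mem v s :=
  all (fun x => x < size mem)%N v /\ [seq mem`_x | x <- v] = s.

Definition computes mem P v s :=
  exists w, [/\ slp_run mem P = Some (mem ++ w), size w = size P & reads (mem ++ w) v s].

Lemma nth_mem_cat mem w x : (x < size mem)%N -> (mem ++ w)`_x = mem`_x.
Proof. by move=> lt_x; rewrite nth_cat lt_x. Qed.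

Lemma reads_cat mem w v s : reads mem v s -> reads (mem ++ w) v s.
Proof.
case=> /allP lt_v <-; split.
  by apply/allP => x /lt_v lt_x; rewrite size_cat ltn_addr.
by apply/eq_in_map => x /lt_v; apply: nth_mem_cat.
Qed.

Lemma reads_cons mem x v s : (x < size mem)%N -> reads mem v s ->
  reads mem (x :: v) (mem`_x :: s).
Proof. by move=> lt_x [lt_v <-]; split; rewrite //= lt_x. Qed.

Lemma computes_mul mem b x v s :
  (b < size mem)%N -> (x < size mem)%N -> reads mem v s ->
  computes mem (mul_code b (size mem) x v) (odd_addrs (size mem) (size v))
    (mul_lin mem`_b mem`_x s).
Proof.
elim: v mem x s => [|y v IH] mem x s lt_b lt_x [/= lt_v <-].
  by exists [::]; rewrite cats0.
case/andP: lt_v => lt_y lt_v.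
(* [w0] holds what the first two instructions append; the induction continues from the memory
   extended by it. *)
pose w0 := [:: mem`_y * mem`_b; mem`_y * mem`_b + mem`_x].
have sz : size (mem ++ w0) = (size mem).+2 by rewrite size_cat addn2.
have [|||w [run_w sz_w rd_w]] := IH (mem ++ w0) y [seq mem`_x | x <- v].
- by rewrite sz !ltnS ltnW // ltnW.
- by rewrite sz !ltnS ltnW // ltnW.
- exact: reads_cat.
move: run_w sz_w rd_w; rewrite sz -catA !nth_mem_cat // => run_w sz_w rd_w.
exists (w0 ++ w); split.
- rewrite /= !nth_rcons ltnn eqxx lt_x.
  by rewrite -!cats1 -!catA.
- by rewrite /= sz_w.
have rd0 : (mem ++ w0 ++ w)`_(size mem).+1 = mem`_y * mem`_b + mem`_x.
  by rewrite nth_cat ltnNge leqnSn /= subSnn.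
rewrite [X in reads _ _ X](_ : _ =
  (mem ++ w0 ++ w)`_(size mem).+1 :: mul_lin mem`_b mem`_y [seq mem`_x | x <- v]);
  last by rewrite rd0.
by apply: reads_cons => //; rewrite size_cat !addnS !ltnS leq_addr.
Qed.

Lemma computes_div mem c x v s :
  (c < size mem)%N -> mem`_c != 0 -> (x < size mem)%N -> reads mem v s ->
  computes mem (div_code c (size mem) x v) (odd_addrs (size mem) (size v))
    (div_lin mem`_c mem`_x s).
Proof.
move=> lt_c c0; elim: v mem x s lt_c c0 => [|y v IH] mem x s lt_c c0 lt_x [/= lt_v <-].
  by exists [::]; rewrite cats0.
case/andP: lt_v => lt_y lt_v.
pose w0 := [:: mem`_y - mem`_x; (mem`_y - mem`_x) / mem`_c].
have sz : size (mem ++ w0) = (size mem).+2 by rewrite size_cat addn2.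
have rd1 w : (mem ++ w0 ++ w)`_(size mem).+1 = (mem`_y - mem`_x) / mem`_c.
  by rewrite nth_cat ltnNge leqnSn /= subSnn.
have [||||w [run_w sz_w rd_w]] := IH (mem ++ w0) (size mem).+1 [seq mem`_x | x <- v].
- by rewrite sz !ltnS ltnW // ltnW.
- by rewrite nth_mem_cat.
- by rewrite sz.
- exact: reads_cat.
have := rd1 [::]; rewrite cats0 => rd0.
move: run_w sz_w rd_w; rewrite sz -catA rd0 !nth_mem_cat // => run_w sz_w rd_w.
exists (w0 ++ w); split.
- rewrite /= !nth_rcons lt_c (negPf c0) ltnn eqxx.
  by rewrite -!cats1 -!catA.
- by rewrite /= sz_w.
rewrite [X in reads _ _ X](_ : _ = (mem ++ w0 ++ w)`_(size mem).+1 ::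
  div_lin mem`_c ((mem`_y - mem`_x) / mem`_c) [seq mem`_x | x <- v]);
  last by rewrite rd1.
by apply: reads_cons => //; rewrite size_cat !addnS !ltnS leq_addr.
Qed.

Lemma computes_step z b v s st mem (e := nth 0 mem) :
  (z < size mem)%N -> mem`_z = 0 -> (b < size mem)%N ->
  (step_addr st < size mem)%N -> step_def e mem`_b st -> reads mem v s ->
  let: (c, v') := step_code z b (size mem) v st in
  computes mem c v' (step_val e mem`_b s st).
Proof.
case: st => y lt_z z0 lt_b lt_y /= def_y rd_v; first exact: computes_mul.
pose mem1 := rcons mem (mem`_b - mem`_y).
have sz : size mem1 = (size mem).+1 by rewrite size_rcons.
have c1 : mem1`_(size mem) = mem`_b - mem`_y by rewrite nth_rcons ltnn eqxx.
have z1 : mem1`_z = 0 by rewrite nth_rcons lt_z.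
have [||||w [run_w sz_w rd_w]] := @computes_div mem1 (size mem) z v s.
- by rewrite sz.
- by rewrite c1 subr_eq0.
- by rewrite sz ltnW.
- by rewrite /mem1 -cats1; apply: reads_cat.
exists ((mem`_b - mem`_y) :: w); rewrite -cat_rcons -/mem1 /=.
by rewrite sz_w -sz; split => //; rewrite -c1 -{2}z1.
Qed.

(** The environment is read in the fixed part [mem0], while [mem1] grows with each step. The zero at
    [z] may lie in either part, as it is stored after the input. *)
Lemma computes_steps z b sts v s mem0 mem1 (mem := mem0 ++ mem1) (e := nth 0 mem0) :
  (z < size mem)%N -> mem`_z = 0 -> (b < size mem0)%N ->
  all (fun st => step_addr st < size mem0)%N sts ->
  all (step_def e (e b)) sts -> reads mem v s ->
  let: (c, v') := steps_code z b (size mem) v sts in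
  computes mem c v' (foldl (step_val e (e b)) s sts).
Proof.
rewrite {}/mem; elim: sts v s mem1 => [|st sts IH] v s mem1 lt_z z0 lt_b /=.
  by move=> _ _ rd_v; exists [::]; rewrite cats0.
move=> /andP[lt_st lt_sts] /andP[def_st def_sts] rd_v.
set mem := mem0 ++ mem1 in lt_z z0 rd_v *.
have le_mem : (size mem0 <= size mem)%N by rewrite size_cat leq_addr.
have eb : mem`_b = e b by rewrite nth_mem_cat.
have est : mem`_(step_addr st) = e (step_addr st) by rewrite nth_mem_cat.
have := @computes_step z b v s st mem lt_z z0 (leq_trans lt_b le_mem)
  (leq_trans lt_st le_mem).
rewrite eb (_ : step_def _ _ st = step_def e (e b) st); last first.
  by case: (st) est => //= y ->.
rewrite (_ : step_val _ _ s st = step_val e (e b) s st); last first.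
  by case: (st) est => //= y ->.
move=> /(_ def_st rd_v); case: step_code => c v' [w [run_w sz_w rd_w]].
have := IH v' (step_val e (e b) s st) (mem1 ++ w).
rewrite catA -/mem [size (mem ++ w)]size_cat sz_w ltn_addr // nth_mem_cat //.
move=> /(_ isT z0 lt_b lt_sts def_sts rd_w).
case: steps_code => c' v'' [w' [run_w' sz_w' rd_w']].
exists (w ++ w'); rewrite slp_run_cat run_w /= catA; split => //.
by rewrite !size_cat sz_w sz_w'.
Qed.

End Semantics.

(** * The whole program, its quadratic cost and its execution *)

Section Program.
Variables (k : nat) (m : 'I_k -> nat).
Notation M := (\sum_(i < k) m i)%N.

(** Extends [m] by 0 to all naturals, because the code of a program is indexed by [nat]. *)
Definition mult (i : nat) : nat := oapp m 0%N (insub i).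

(** The input stores a_j at address M + j; repeating it m_j times divides by the m_j-th power of its
    linear factor. *)
Definition pole_steps (i : nat) : seq nat :=
  flatten [seq nseq (m j) (M + j)%N | j <- enum 'I_k & val j != i].

Definition iter_steps (i : nat) : seq step :=
  rev (map SMul (iota 0 M)) ++ map SDiv (pole_steps i).

(* The initial IZero stores at address L the zero coefficients from which
   Horner's scheme starts. *)
Definition iter_prog (i L : nat) : seq instr * seq nat :=
  let: (c, v) := steps_code L (M + i) L.+1 (nseq (mult i) L) (iter_steps i) in
  (IZero :: c, v).

(** Addresses are absolute, so the code of an iteration depends on the memory length left by the
    previous ones, starting from the M + k inputs. *)
Fixpoint iter_start (n : nat) : nat :=
  if n is n'.+1 then (iter_start n' + size (iter_prog n' (iter_start n')).1)%N
  else (M + k)%N.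

Definition iter_addrs (i : nat) : seq nat := (iter_prog i (iter_start i)).2.

Definition pf_prog : pf_program :=
  PfProgram (fun i => (iter_prog i (iter_start i)).1)
    (fun n => flatten [seq [seq (nth 0%N (iter_addrs i) (mult i - j), M + i, j)%N
                           | j <- iota 1 (mult i)] | i <- iota 0 n]).

Lemma mult_ord (i : 'I_k) : mult i = m i.
Proof. by rewrite /mult valK. Qed.

Lemma size_iter_steps (i : nat) : (size (iter_steps i) <= M + M)%N.
Proof.
rewrite size_cat size_rev !size_map size_iota leq_add2l size_flatten /shape.
rewrite sumnE !big_map big_filter big_enum_cond /= big_mkcond /=.
by apply: leq_sum => j _; case: ifP; rewrite ?size_nseq.
Qed.

Lemma slp_cost_iter (i L : nat) :
  slp_cost (iter_prog i L).1 = (size (iter_steps i) * mult i)%N.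
Proof.
rewrite /iter_prog.
have := slp_cost_steps L (M + i) L.+1 (nseq (mult i) L) (iter_steps i).
by case: steps_code => c v /=; rewrite slp_cost_cons size_nseq.
Qed.

Lemma pf_prog_cost : (pf_program_cost pf_prog k <= 2 * M ^ 2)%N.
Proof.
(* Iteration i runs at most 2M steps on m_i coefficients, and the m_i sum to M. *)
have -> : (2 * M ^ 2 = \sum_(i < k) (M + M) * m i)%N.
  by rewrite -big_distrr /= addnn -mul2n -mulnA.
apply: leq_sum => i _.
by rewrite slp_cost_iter mult_ord leq_mul2r size_iter_steps orbT.
Qed.

Section Correctness.
Variables (K : fieldType) (a : 'I_k -> K) (N : {poly K}).
Hypotheses (a_inj : injective a) (ltN : (size N < size (pf_den a m))%N).
Notation input := (pf_input a m N).

Lemma size_pf_input : size input = (M + k)%N.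
Proof. by rewrite size_cat size_mkseq size_map size_enum_ord. Qed.

Lemma nth_input_coef (n : nat) : (n < M)%N -> input`_n = N`_n.
Proof. by move=> nM; rewrite nth_cat size_mkseq nM nth_mkseq. Qed.

Lemma nth_input_pole (i : 'I_k) : input`_(M + i) = a i.
Proof.
rewrite nth_cat size_mkseq ltnNge leq_addr /= addKn.
by rewrite (nth_map i) ?size_enum_ord // nth_ord_enum.
Qed.

Lemma mem_pole_steps (i y : nat) :
  y \in pole_steps i -> exists2 j : 'I_k, val j != i & y = (M + j)%N.
Proof.
case/flatten_mapP => j; rewrite mem_filter => /andP[ji _].
by rewrite mem_nseq => /andP[_ /eqP ->]; exists j.
Qed.

Lemma prod_pole_steps (i : 'I_k) :
  \prod_(y <- pole_steps i) ('X + (a i - input`_y)%:P) = shift_coden a m i.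
Proof.
rewrite big_flatten big_map big_filter big_enum_cond /=.
by apply: eq_bigr => j _; rewrite big_nseq nth_input_pole iter_mulr_1.
Qed.

Lemma pole_steps_neq (i : 'I_k) : all (fun y => a i != input`_y) (pole_steps i).
Proof.
apply/allP => y /mem_pole_steps[j ji ->].
by rewrite nth_input_pole (inj_eq a_inj) eq_sym.
Qed.

Lemma iter_steps_val (i : 'I_k) :
  foldl (step_val (nth 0 input) (a i)) (nseq (m i) 0) (iter_steps i) =
  mkseq (nth 0 (pf_trunc a m N i)) (m i).
Proof.
rewrite /iter_steps foldl_cat.
have := mul_steps_val (nth 0 input) (a i) (m i) (iota 0 M).
(* The M stored coefficients are all of [N], as its degree is below M. *)
have -> : Poly [seq input`_y | y <- iota 0 M] = N.
  apply/polyP => n; rewrite coef_Poly; case: (ltnP n M) => [nM|Mn].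
    by rewrite (nth_map 0%N) ?size_iota // nth_iota // nth_input_coef.
  rewrite !nth_default ?size_map ?size_iota //.
  by rewrite (leq_trans _ Mn) // -ltnS -(size_pf_den a m).
set s1 := foldl _ _ _ => /= dv1.
have sz1 : size s1 = m i by rewrite size_steps_val size_nseq.
have := div_steps_val s1 (pole_steps_neq i); rewrite /= prod_pole_steps sz1.
set s2 := foldl _ _ _ => dv2.
have sz2 : size s2 = m i by rewrite size_steps_val.
have -> : pf_trunc a m N i = Poly s2.
  apply/esym/ps_trunc_unique; first exact: shift_coden0.
    by rewrite (leq_trans (size_Poly _)) ?sz2.
  (* Adding the Horner and division congruences cancels [Poly s1] and leaves the one characterizing
     the truncation. *)
  have := dvdp_add dv1 dv2; rewrite addrA subrK; exact.
apply: (@eq_from_nth _ 0) => [|n]; rewrite sz2 ?size_mkseq // => nm.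
by rewrite nth_mkseq // coef_Poly.
Qed.

Lemma computes_iter (i : 'I_k) (w : seq K) :
  computes (input ++ w) (iter_prog i (size (input ++ w))).1
    (iter_prog i (size (input ++ w))).2 (mkseq (nth 0 (pf_trunc a m N i)) (m i)).
Proof.
set mem := input ++ w; rewrite -iter_steps_val -(nth_input_pole i).
(* The trailing 0 in [rcons w 0] is the value stored by [IZero]; it serves as every initial
   coefficient and as the seed of each division. *)
have := @computes_steps K (size mem) (M + i) (iter_steps i)
  (nseq (m i) (size mem)) (nseq (m i) 0) input (rcons w 0).
cbv zeta; rewrite -rcons_cat -/mem size_rcons ltnS leqnn nth_rcons ltnn eqxx.
rewrite size_pf_input ltn_add2l => /(_ isT erefl (ltn_ord i)).
rewrite /iter_prog mult_ord; case: steps_code => c v h.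
have [|||w' [run_w' sz_w' rd_w']] := h.
- rewrite all_cat all_rev !all_map; apply/andP; split; apply/allP => y.
    by rewrite mem_iota /= => lt_y; rewrite ltn_addr.
  by case/mem_pole_steps => j _ -> /=; rewrite ltn_add2l.
- rewrite all_cat all_rev !all_map; apply/andP; split; first by apply/allP.
  by rewrite nth_input_pole; apply: pole_steps_neq.
- split; first by rewrite all_nseq size_rcons ltnS leqnn orbT.
  by rewrite map_nseq nth_rcons ltnn eqxx.
exists (0 :: w'); rewrite /= -cat_rcons; split => //.
by rewrite sz_w'.
Qed.

(** The memory is only ever extended, so the coefficients found by earlier iterations stay readable
    at their addresses. *)
Lemma pf_prog_run (n : nat) : (n <= k)%N ->
  exists w, [/\ slp_run input (flatten [seq iter_code pf_prog i | i <- iota 0 n])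
                  = Some (input ++ w),
                size (input ++ w) = iter_start n
              & forall i : 'I_k, (i < n)%N ->
                  reads (input ++ w) (iter_addrs i)
                    (mkseq (nth 0 (pf_trunc a m N i)) (m i))].
Proof.
elim: n => [_|n IH lt_nk].
  by exists [::]; rewrite cats0; split; rewrite ?size_pf_input.
have [w [run_w sz_w rd_w]] := IH (ltnW lt_nk).
have [w' [run_w' sz_w' rd_w']] := computes_iter (Ordinal lt_nk) w.
rewrite -addn1 iotaD map_cat flatten_cat /= cats0 slp_run_cat run_w /=.
exists (w ++ w'); rewrite catA addn1; split => [||i].
- by rewrite -sz_w.
- by rewrite size_cat sz_w' sz_w.
rewrite ltnS leq_eqVlt => /orP[/eqP in_|lt_in]; last by apply/reads_cat/rd_w.
have -> : i = Ordinal lt_nk by apply: val_inj.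
by rewrite /iter_addrs /= -sz_w.
Qed.

Lemma pf_prog_executes : executes a m N pf_prog.
Proof.
move=> n le_nk; have [w [run_w sz_w rd_w]] := pf_prog_run le_nk.
exists (input ++ w) => //; rewrite pf_stateE /pf_read /= map_flatten -map_comp.
have <- : [seq val i | i <- take n (enum 'I_k)] = iota 0 n.
  by rewrite map_take val_enum_ord take_iota (minn_idPl le_nk).
rewrite -map_comp; congr flatten; apply/eq_in_map => i i_in /=.
have lt_in : (i < n)%N.
  have : val i \in [seq val i | i <- take n (enum 'I_k)] by rewrite map_f.
  by rewrite map_take val_enum_ord take_iota mem_iota (minn_idPl le_nk).
have [lt_v rd_v] := rd_w i lt_in; rewrite -map_comp mult_ord.
apply/eq_in_map => j; rewrite mem_iota add1n ltnS => /andP[j0 jm] /=.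
have lt_mj : (m i - j < m i)%N by rewrite ltn_subrL j0 (leq_trans j0).
have sz_v : size (iter_addrs i) = m i by rewrite -(size_map (nth 0 (input ++ w))) rd_v size_mkseq.
congr (_, _, _).
  by rewrite -(nth_map _ 0 (nth 0 (input ++ w))) ?sz_v // rd_v nth_mkseq.
by rewrite nth_mem_cat ?nth_input_pole // size_pf_input ltn_add2l.
Qed.

End Correctness.
End Program.

Theorem theorem12 :
  (forall (K : closedFieldType) (k : nat) (a : 'I_k -> K) (m : 'I_k -> nat)
      (N : {poly K}),
    injective a -> (forall i, (0 < m i)%N) ->
    (size N < size (pf_den a m))%N ->
    (forall i : 'I_k,
       is_Frac (tau (a i) (pf_rat a m N)) 'X^(m i)
         (pf_eval (pf_of_trunc (m i) (pf_trunc a m N i)))) /\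
    is_pfd a m (pf_rat a m N) (pf_algorithm a m N)) /\
  (exists (P : forall k : nat, ('I_k -> nat) -> pf_program) (C : nat),
    forall (k : nat) (m : 'I_k -> nat), (forall i, (0 < m i)%N) ->
    (pf_program_cost (P k m) k <= C * (\sum_(i < k) m i) ^ 2)%N /\
    (forall (K : closedFieldType) (a : 'I_k -> K) (N : {poly K}),
       injective a -> (size N < size (pf_den a m))%N ->
       executes a m N (P k m))).
Proof.
split=> [K k a m N a_inj _ ltN|].
  by split=> [i|]; [apply: is_Frac_pf_trunc | apply: pf_algorithm_is_pfd].
(* The program is built from k and the multiplicities alone, so one program serves all fields, poles
   and numerators. *)
exists pf_prog, 2 => k m _; split=> [|K a N a_inj ltN]; first exact: pf_prog_cost.
exact: pf_prog_executes.
Qed.
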